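(* Let $({\bf s}_i,Y_i)_{1\le i\le n}$ be i.i.d. in $\Omega\times\mathbb R$ with ${\bf s}_i\sim\nu$ and, conditionally on ${\bf s}_i$, $Y_i\sim\mathbf N(u_\star({\bf s}_i),\sigma^2)$ with $\sigma^2$ known, where $u_\star=u_{\theta_\star}$ is the unique solution of the PDE described in the context for some unknown parameter $\theta_\star\in\Theta$. Here $\Theta\subset\mathbb R^d$ is compact, and for each $\theta\in\Theta$ the PDE (including the initial/boundary condition) admits a unique solution $u_\theta\in\mathcal C^\beta(\Omega)$, for a given fixed $\beta$. Let $\Gamma:\Theta\to\mathcal C^\beta(\Omega)$, $\Gamma(\theta)=u_\theta$, and assume that there exists a constant $L>0$ such that $$|\Gamma(\theta_1)-\Gamma(\theta_2)|_\infty\le L\|\theta_1-\theta_2\|_2\qquad\forall\,\theta_1,\theta_2\in\Theta.$$ Then any solution $\hat u$ of $$\hat u\in\operatorname*{argmin}_{u\in\Gamma(\Theta)}\frac1n\sum_{i=1}^n(Y_i-u({\bf s}_i))^2,\qquad \Gamma(\Theta)=\{\Gamma(\theta):\theta\in\Theta\},$$ satisfies $$|\hat u-u_\star|_2^2=O_p\left(\frac dn\log\left(\frac nd\right)\right)\qquad (n\to\infty).$$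
   Context: $\Omega\subset\mathbb R^m$ is a bounded open domain with smooth boundary, $\nu$ a probability measure on $\Omega$. $L^2(\Omega,\mathbb R^j,\nu)$ is the space of square-$\nu$-integrable $\mathbb R^j$-valued functions, with norm $|f|_2=(\int_\Omega\|f\|_2^2\,d\nu)^{1/2}$; $|f|_\infty=\sup_{x\in\Omega}\|f(x)\|_\infty$. The PDE with parameter $\theta\in\mathbb R^d$ is $\mathcal H_0u+\theta^{\mathsf T}\mathcal H_1u=f$ with initial/boundary condition $\mathcal Bu={\bf 0}$, where $f\in L^2(\Omega,\mathbb R,\nu)$ is known, $\mathcal H_0:L^2(\Omega,\mathbb R,\nu)\to L^2(\Omega,\mathbb R,\nu)$ and $\mathcal H_1:L^2(\Omega,\mathbb R,\nu)\to L^2(\Omega,\mathbb R^d,\nu)$ are differential operators, and $\mathcal B:L^2(\Omega,\mathbb R,\nu)\to L^2(\Omega,\mathbb R^{d_1},\nu)$. Standing assumption: $\mathcal H=(\mathcal H_0,\mathcal H_1)$ is of order $\tau>0$, meaning that for all $\beta>\tau$ and $u,v\in\mathcal C^\beta(\Omega)$, $|\mathcal Hu-\mathcal Hv|_2\le C_0\max_{|{\bf k}|\le\tau}|D^{\bf k}u-D^{\bf k}v|_\infty$ for an absolute constant $C_0$. $\mathcal C^\beta(\Omega)$ is the space of functions $u:\Omega\to\mathbb R$ with finite Hölder norm of order $\beta$. $X_n=O_p(a_n)$ means that $X_n/a_n$ is bounded in probability. *)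

(* Defs.v *)
From HB Require Import structures.
From mathcomp Require Import all_boot all_order all_algebra finmap.
From mathcomp Require Import all_classical all_reals all_analysis.

Set Implicit Arguments.
Unset Strict Implicit.
Unset Printing Implicit Defensive.

Import Order.TTheory GRing.Theory Num.Theory.
Import numFieldNormedType.Exports.

Local Open Scope classical_set_scope.
Local Open Scope ring_scope.

(* R^m with its Borel sigma-algebra; convertible to 'rV[R]_m. *)
Notation borelRV R m := (g_sigma_algebraType (@open 'rV[R]_m)).

Section function_spaces.
Context {R : realType}.

(* The library norm `|v| on 'rV[R]_j is the max norm. *)
Definition enorm j (v : 'rV[R]_j) : R := Num.sqrt (\sum_i v 0 i ^+ 2).

Definition boundary m (Om : set 'rV[R]_m) : set 'rV[R]_m :=
  closure Om `\` interior Om.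

(* A function on a domain Om is represented by a total function on R^m of
   which only the values on Om matter. As Om is open, partial derivatives at
   points of Om only depend on those values. *)

Definition partial m (i : 'I_m) (u : 'rV[R]_m -> R) : 'rV[R]_m -> R :=
  fun x => 'D_(delta_mx 0 i) u x.

Definition pderiv m (w : seq 'I_m) (u : 'rV[R]_m -> R) : 'rV[R]_m -> R :=
  foldr (@partial m) u w.

(* Partial derivatives of all orders in N, taken in any order of the
   variables, exist and are continuous on U. *)
Definition cont_diff_on m (U : set 'rV[R]_m) (N : set nat)
    (u : 'rV[R]_m -> R) : Prop :=
  forall w : seq 'I_m, N (size w) -> forall x, U x ->
    {for x, continuous (pderiv w u)} /\
    (forall i, N (size w).+1 -> derivable (pderiv w u) x (delta_mx 0 i)).

(* Near each boundary point, Om is one side of a smooth regular hypersurface. *)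
Definition smooth_boundary m (Om : set 'rV[R]_m) : Prop :=
  forall p, boundary Om p ->
  exists (U : set 'rV[R]_m) (phi : 'rV[R]_m -> R),
    [/\ open U, U p, cont_diff_on U setT phi,
        (exists i, partial i phi p != 0) &
        Om `&` U = U `&` [set x | phi x < 0]].

Definition multi_index m := {ffun 'I_m -> nat}.

Definition mi_size m (k : multi_index m) : nat := (\sum_i k i)%N.

Definition mderiv m (k : multi_index m) : ('rV[R]_m -> R) -> 'rV[R]_m -> R :=
  pderiv (flatten [seq nseq (k i) i | i <- enum 'I_m]).

Definition supnorm m (Om : set 'rV[R]_m) (u : 'rV[R]_m -> R) : \bar R :=
  ereal_sup [set (`|u x|)%:E | x in Om].

(* The order of the top derivatives is the largest integer strictly smaller
   than beta, so the Hoelder exponent beta - |k| lies in ]0, 1]. *)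
Definition holder_norm m (Om : set 'rV[R]_m) (beta : R) (u : 'rV[R]_m -> R) :
    \bar R :=
  adde
    (ereal_sup [set supnorm Om (mderiv k u)
                 | k in [set k : multi_index m | (mi_size k)%:R < beta]])
    (ereal_sup [set q | exists (k : multi_index m) (x y : 'rV[R]_m),
       [/\ (mi_size k)%:R < beta <= (mi_size k).+1%:R, Om x, Om y, x != y &
           q = (`|mderiv k u x - mderiv k u y|
                 / enorm (x - y) `^ (beta - (mi_size k)%:R))%:E]]).

Definition holder_space m (Om : set 'rV[R]_m) (beta : R) :
    set ('rV[R]_m -> R) :=
  [set u | cont_diff_on Om [set r : nat | r%:R < beta] u /\
           (holder_norm Om beta u < +oo)%E].

End function_spaces.

Section operators.
Context {R : realType} {m : nat}.
Variables (Om : set 'rV[R]_m) (nu : probability (borelRV R m) R).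

Definition L2norm j (f : 'rV[R]_m -> 'rV[R]_j) : \bar R :=
  ((\int[nu]_(x in Om) ((enorm (f x)) ^+ 2)%:E) `^ 2^-1)%E.

Definition in_L2 j (f : 'rV[R]_m -> 'rV[R]_j) : Prop :=
  @measurable_fun _ _ (borelRV R m) (borelRV R j) Om f /\ (L2norm f < +oo)%E.

(* Scalar functions as functions with values in R^1. *)
Definition scal (u : 'rV[R]_m -> R) : 'rV[R]_m -> 'rV[R]_1 :=
  fun x => (u x)%:M.

Definition ae_on j (f g : 'rV[R]_m -> 'rV[R]_j) : Prop :=
  {ae nu, forall x, Om x -> f x = g x}.

(* A map L^2(Om, R, nu) -> L^2(Om, R^j, nu): it acts on representatives and
   is compatible with nu-almost everywhere equality. *)
Definition L2_operator j (H : ('rV[R]_m -> R) -> 'rV[R]_m -> 'rV[R]_j) :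
    Prop :=
  (forall u, in_L2 (scal u) -> in_L2 (H u)) /\
  (forall u v, in_L2 (scal u) -> in_L2 (scal v) ->
     ae_on (scal u) (scal v) -> ae_on (H u) (H v)).

Definition jet (tau : R) (u : 'rV[R]_m -> R) (x : 'rV[R]_m) :
    multi_index m -> R :=
  fun k => if (mi_size k)%:R <= tau then mderiv k u x else 0.

(* Possibly nonlinear differential operators with derivatives of order at most
   tau: (H u)(x) = F (x, (D^k u(x))_(|k| <= tau)) on smooth enough u. *)
Definition differential_operator (tau : R) j
    (H : ('rV[R]_m -> R) -> 'rV[R]_m -> 'rV[R]_j) : Prop :=
  exists F : 'rV[R]_m -> (multi_index m -> R) -> 'rV[R]_j,
  forall (beta : R) u, tau < beta -> holder_space Om beta u ->
    ae_on (H u) (fun x => F x (jet tau u x)).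

Definition operator_of_order (tau : R) j
    (H : ('rV[R]_m -> R) -> 'rV[R]_m -> 'rV[R]_j) : Prop :=
  exists2 C0 : R, 0 < C0 &
  forall (beta : R) u v, tau < beta ->
    holder_space Om beta u -> holder_space Om beta v ->
    (L2norm (fun x => H u x - H v x)%R <=
     C0%:E * ereal_sup [set supnorm Om (fun x => mderiv k u x - mderiv k v x)%R
                         | k in [set k : multi_index m |
                                  ((mi_size k)%:R <= tau)%R]])%E.

Definition joint_operator d (H0 : ('rV[R]_m -> R) -> 'rV[R]_m -> R)
    (H1 : ('rV[R]_m -> R) -> 'rV[R]_m -> 'rV[R]_d) :
    ('rV[R]_m -> R) -> 'rV[R]_m -> 'rV[R]_(1 + d) :=
  fun u x => row_mx (scal (H0 u) x) (H1 u x).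

(* H0 u + theta^T H1 u = f and B u = 0, both in the L^2 sense. *)
Definition solves_pde d d1 (H0 : ('rV[R]_m -> R) -> 'rV[R]_m -> R)
    (H1 : ('rV[R]_m -> R) -> 'rV[R]_m -> 'rV[R]_d)
    (B : ('rV[R]_m -> R) -> 'rV[R]_m -> 'rV[R]_d1)
    (f : 'rV[R]_m -> R) (theta : 'rV[R]_d) (u : 'rV[R]_m -> R) : Prop :=
  ae_on (scal (fun x => H0 u x + \sum_i theta 0 i * H1 u x 0 i)) (scal f) /\
  ae_on (B u) (fun=> 0).

End operators.

Section probability_notions.
Context {R : realType} d (T : measurableType d) (P : probability T R).

Definition mutually_independent d' (E : measurableType d') (X : nat -> T -> E) :
    Prop :=
  forall (J : {fset nat}) (A : nat -> set E),
    (forall i, i \in J -> measurable (A i)) ->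
    P (\bigcap_(i in [set` J]) (X i @^-1` A i)) =
    (\prod_(i <- J) P (X i @^-1` A i))%E.

(* Conditionally on s, Y ~ N(u(s), sigma^2); the library's [normal_prob] is
   parameterized by the standard deviation. *)
Definition conditionally_normal m (s : {RV P >-> borelRV R m})
    (Y : {RV P >-> R}) (u : 'rV[R]_m -> R) (sigma : R) : Prop :=
  forall (A : set (borelRV R m)) (B : set R), measurable A -> measurable B ->
    P (s @^-1` A `&` Y @^-1` B) =
    (\int[P]_(w in s @^-1` A) normal_prob (u (s w)) sigma B)%E.

(* [mu_ext P] is the outer probability, equal to P on measurable sets: the
   X n are not required to be measurable. *)
Definition bounded_in_probability (X : nat -> T -> \bar R) : Prop :=
  forall eps : R, 0 < eps -> exists M : R,
  \forall n \near \oo,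
    (mu_ext P [set w | M%:E < `|X n w| ] <= eps%:E)%E.

Definition Op (X : nat -> T -> \bar R) (a : nat -> R) : Prop :=
  bounded_in_probability (fun n w => X n w * ((a n)^-1)%:E)%E.

End probability_notions.

Definition is_argmin {R : realType} {A : Type} (F : set A) (Q : A -> R)
    (a : A) : Prop :=
  F a /\ forall b, F b -> Q a <= Q b.

(* Main.v *)
Require Import Defs.
From HB Require Import structures.
From mathcomp Require Import all_boot all_order all_algebra finmap.
From mathcomp Require Import all_classical all_reals all_analysis.
From mathcomp Require Import measurable_realfun ring lra.

(* The proof compares squared losses at the scale of likelihood ratios. With
   e = Y - u*(s) Gaussian given s and D = u - u*,
     (Y - u*(s))^2 - (Y - u(s))^2 = 2 e D(s) - D(s)^2,
   and multiplying by 1/(4 sigma^2) balances the two terms: the conditional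
   exponential moment is exactly exp(- D(s)^2 / (8 sigma^2)). Since D is bounded
   by K on the class, the unconditional one is at most exp(- c |D|_2^2) with
   c = 1/(8 sigma^2 + K^2). By independence, a fixed u with |u - u*|_2^2 >= rho
   beats u* on n observations, up to a constant, with probability
   O(exp(- c n rho)). The theorem follows by a union bound over a net of
   O((n/d)^d) parameters of mesh d/n: passing from the minimiser to its
   neighbour in the net costs O(1) in the total squared loss as long as
   sum_i |e_i| = O(n), which holds with high probability by Markov's
   inequality, and for rho a large multiple of (d/n) log(n/d) the bound
   exp(- c n rho) absorbs the cardinality of the net. *)

Set Implicit Arguments.
Unset Strict Implicit.
Unset Printing Implicit Defensive.

Import Order.TTheory GRing.Theory Num.Theory.
Import numFieldNormedType.Exports.

Local Open Scope classical_set_scope.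
Local Open Scope ring_scope.

(** * Integration against a measure with a density *)

Section density.
Local Open Scope ereal_scope.
Context d (S : measurableType d) (R : realType).
Variables (mu : {measure set S -> \bar R}) (p : S -> R).
Hypotheses (mp : measurable_fun setT p) (p0 : forall x, (0 <= p x)%R).

Let mEp D : measurable_fun D (EFin \o p).
Proof. by apply: measurable_funTS; exact/measurable_EFinP. Qed.

Let Ep0 x : 0 <= (p x)%:E.
Proof. by rewrite lee_fin. Qed.

Definition density_measure (A : set S) : \bar R := \int[mu]_(x in A) (p x)%:E.

Let density_measure0 : density_measure set0 = 0.
Proof. exact: integral_set0. Qed.

Let density_measure_ge0 A : 0 <= density_measure A.
Proof. exact: integral_ge0. Qed.

Let density_measure_additive : semi_sigma_additive density_measure.
Proof.
move=> F mF tF mUF; rewrite /density_measure ge0_integral_bigcup//.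
by apply: is_cvg_nneseries => n _ _; exact: integral_ge0.
Qed.

HB.instance Definition _ := isMeasure.Build _ _ _ density_measure
  density_measure0 density_measure_ge0 density_measure_additive.

Definition density : {measure set S -> \bar R} := density_measure.

Import HBNNSimple.

(** For an indicator this is the definition of the measure; linearity gives simple functions and
    monotone convergence the rest. *)
Lemma ge0_integral_density (f : S -> \bar R) :
  measurable_fun [set: S] f -> (forall x, 0 <= f x) ->
  \int[density]_x f x = \int[mu]_x (f x * (p x)%:E).
Proof.
move=> mf f0; pose f_ := nnsfun_approx measurableT mf.
have f_nd x : {homo (fun n => (f_ n x)%:E) : m n / (m <= n)%N >-> m <= n}.
  by move=> m n mn; rewrite lee_fin; exact/lefP/nd_nnsfun_approx.
have f_cvg x : (f_ n x)%:E @[n --> \oo] --> f x.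
  by apply: cvg_nnsfun_approx => // ? _; exact: f0.
transitivity (limn (fun n => \int[density]_x (f_ n x)%:E)).
  rewrite -monotone_convergence//.
  - by apply: eq_integral => x _; apply/esym/cvg_lim => //; exact: f_cvg.
  - by move=> n; exact/measurable_EFinP/measurable_funP.
  - by move=> n x _; rewrite lee_fin.
rewrite [X in limn X = _](_ : _ =
    fun n => \int[mu]_x ((f_ n x)%:E * (p x)%:E)); last first.
  apply/funext => n; rewrite integralT_nnsfun sintegralE.
  under [RHS]eq_integral => x _.
    rewrite fimfunE -fsumEFin// ge0_mule_fsuml; last first.
      by move=> r; rewrite nnfun_muleindic_ge0.
    over.
  rewrite ge0_integral_fsum//; last 2 first.
  - move=> r; apply: emeasurable_funM => //.
    by apply/measurable_EFinP; exact: measurable_funM.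
  - by move=> r x _; rewrite mule_ge0// nnfun_muleindic_ge0.
  apply: eq_fsbigr => r /[!inE] -[t _ <-].
  under eq_integral do rewrite EFinM -muleA.
  rewrite ge0_integralZl//; last 3 first.
  - by apply: emeasurable_funM => //; exact/measurable_EFinP.
  - by move=> x _; rewrite mule_ge0// lee_fin.
  - by rewrite lee_fin.
  congr (_ * _); rewrite /= /density_measure integral_mkcond.
  apply: eq_integral => x _; rewrite patchE indicE.
  by case: ifPn => _; rewrite ?mul1e ?mul0e.
rewrite -monotone_convergence//.
- by apply: eq_integral => x _; apply/cvg_lim => //; exact: cvgeZr.
- by move=> n; apply: emeasurable_funM => //; exact/measurable_EFinP.
- by move=> n x _; rewrite mule_ge0// lee_fin.
- by move=> x _ m n mn; rewrite lee_wpmul2r//; exact: f_nd.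
Qed.

(** [M] is the image under [phi] of the measure with density [p], so this is a change of variables,
    valid even when [p] is not a function of [phi]. *)
Lemma ge0_integral_density_pushforward d' (E : measurableType d')
    (phi : S -> E) (M : {measure set E -> \bar R}) (f : E -> \bar R) :
  measurable_fun setT phi ->
  (forall A, measurable A ->
     \int[mu]_(x in phi @^-1` A) (p x)%:E = M A) ->
  measurable_fun setT f -> (forall y, 0 <= f y) ->
  \int[M]_y f y = \int[mu]_x (f (phi x) * (p x)%:E).
Proof.
move=> mphi MA mf f0.
rewrite -(ge0_integral_density (measurableT_comp mf mphi)); last first.
  by move=> x; exact: f0.
have <- := ge0_integral_pushforward mphi density measurableT mf
  (fun y _ => f0 y).
by apply: eq_measure_integral => A mA _; rewrite /= /pushforward -MA.
Qed.

End density.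

(** * Expectations of products of independent factors *)

Section independence.
Context d d' (T : measurableType d) (E : measurableType d') (R : realType).
Variables (P : probability T R) (X : nat -> T -> E).
Hypotheses (mX : forall i, measurable_fun [set: T] (X i)).
Hypothesis (Xindep : mutually_independent P X).

Let measurable_preX i A : measurable A -> measurable (X i @^-1` A).
Proof. by move=> mA; rewrite -[_ @^-1` _]setTI; exact: mX. Qed.

Let expectation_indic i (A : set E) : measurable A ->
  (\int[P]_w (\1_A (X i w))%:E)%E = P (X i @^-1` A).
Proof.
move=> mA; rewrite -[in RHS](setIT (X i @^-1` A)) -integral_indic//.
exact: measurable_preX.
Qed.

(* The factors are turned from indicators into arbitrary functions one at a
   time: with the others fixed, both sides are measures in the set of the
   k-th factor, so that no generating-class argument is needed. *)
Lemma expectation_prod_partial n k (F : nat -> E -> R) :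
  (forall i, measurable_fun [set: E] (F i)) ->
  (forall i x, 0 <= F i x) ->
  (forall i, (\int[P]_w (F i (X i w))%:E < +oo)%E) ->
  (forall i, (k <= i < n)%N -> exists2 A, measurable A & F i = \1_A) ->
  (\int[P]_w (\prod_(i < n) F i (X i w))%:E =
   \prod_(i < n) \int[P]_w (F i (X i w))%:E)%E.
Proof.
elim: k F => [|k IH] F mF F0 Foo FA.
  (* Base case: the product of the indicators is the indicator of an intersection, to which
     independence applies. Beyond [n], [setT] is a default that lets [choice] return a total
     family. *)
  have FA' i : exists A, measurable A /\ ((i < n)%N -> F i = \1_A).
    have [/(FA i)[A mA FE]|ni] := ltnP i n; first by exists A.
    by exists setT; split.
  have [A /all_and2[mA FE]] := choice FA'.
  under [RHS]eq_bigr => i _.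
    rewrite FE// expectation_indic//.
    over.
  pose J := seq_fset tt (iota 0 n).
  have JE i : (i \in J) = (i < n)%N by rewrite seq_fsetE mem_iota.
  have Jprod : (\prod_(i < n) P (X i @^-1` A i) =
      \prod_(i <- J) P (X i @^-1` A i))%E.
    rewrite (perm_big _ (seq_fset_perm tt (iota 0 n))) undup_id ?iota_uniq//.
    by rewrite -[in RHS](subn0 n) big_mkord.
  rewrite Jprod -Xindep; last by move=> i _; exact: mA.
  have mB : measurable (\bigcap_(i in [set` J]) (X i @^-1` A i)).
    apply: fin_bigcap_measurable => [|i _]; first exact: finite_fset.
    exact: measurable_preX.
  rewrite -[in RHS](setIT (\bigcap_(i in _) _)) -integral_indic//.
  apply: eq_integral => w _; congr EFin; rewrite indicE.
  have [/set_mem wB|/negP wB] := boolP (w \in _).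
    rewrite big1// => i _; rewrite FE// indicE mem_set//.
    by apply: wB; rewrite /= JE.
  have [i iJ /= iA] : exists2 i, (i < n)%N & ~ A i (X i w).
    apply: contrapT => nA; apply: wB; apply/mem_set => i /=; rewrite JE => iJ.
    by apply: contrapT => iA; apply: nA; exists i.
  by rewrite (bigD1 (Ordinal iJ))//= FE// indicE memNset// mul0r.
have [nk|kn] := leqP n k.
  by apply: IH => // i /andP[/(leq_trans nk)/leq_gtF->].
(* [G A] puts an indicator in place of the [k]-th factor, so the induction hypothesis applies to it.
   [W] is the product of the other factors and [c] the product of their expectations. *)
pose G A i : E -> R := if i == k then \1_A else F i.
pose c := (\prod_(i < n | i != Ordinal kn) \int[P]_w (F i (X i w))%:E)%E.
pose W w := \prod_(i < n | i != Ordinal kn) F i (X i w).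
have c_fin : c \is a fin_num.
  apply: prode_fin_num => i _; rewrite ge0_fin_numE// integral_ge0// => w _.
  by rewrite lee_fin.
have W0 w : 0 <= W w by apply: prodr_ge0.
have mW : measurable_fun [set: T] W.
  rewrite /W; under eq_fun do rewrite big_mkcond.
  apply: (@measurable_prod _ T R setT 'I_n (index_enum _)
    (fun i w => if i != Ordinal kn then F i (X i w) else 1)) => i _.
  case: (i != _) => //=.
  exact: measurableT_comp (mF i) (mX i).
have IHG A : measurable A ->
    (\int[P]_(w in X k @^-1` A) (W w)%:E = c * P (X k @^-1` A))%E.
  move=> mA.
  have GA i : i != Ordinal kn -> G A i = F i.
    by move=> ik; rewrite /G (_ : (i == k :> nat) = false)//; apply/negbTE.
  have := IH (G A).
  under eq_integral do rewrite (bigD1 (Ordinal kn))//= EFinM.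
  rewrite (bigD1 (Ordinal kn))//=.
  have GAk : G A k = \1_A by rewrite /G eqxx.
  rewrite GAk expectation_indic// => {}IH.
  rewrite muleC [c](_ : _ = \prod_(i < n | i != Ordinal kn)
      \int[P]_w (G A i (X i w))%:E)%E; last first.
    by apply: eq_bigr => i ik; rewrite GA.
  rewrite -IH.
  - rewrite integral_mkcond; apply: eq_integral => w _.
    rewrite patchE indicE (eq_bigr (fun i : 'I_n => F i (X i w))); last first.
      by move=> i ik; rewrite GA.
    rewrite -/(W w) (_ : (w \in X k @^-1` A) = (X k w \in A)).
      by case: ifPn => _; rewrite ?mul1e ?mul0e.
    by apply/idP/idP; rewrite !inE.
  - by move=> i; rewrite /G; case: ifP.
  - by move=> i x; rewrite /G; case: ifP => // _; rewrite indicE.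
  - move=> i; rewrite /G; case: ifP => // _.
    rewrite expectation_indic// (le_lt_trans _ (ltry 1))//.
    by rewrite probability_le1//; exact: measurable_preX.
  - move=> i; rewrite leq_eqVlt /G eq_sym.
    case: eqP => /= [_ _|_]; first by exists A.
    exact: FA.
pose Xk : {mfun T >-> E} :=
  HB.pack (X k) (isMeasurableFun.Build _ _ _ _ _ (mX k)).
have cn0 : 0 <= fine c.
  rewrite fine_ge0// prode_ge0// => i _; apply: integral_ge0 => w _.
  by rewrite lee_fin.
(* By [IHG], [c] times the law of [X k] is the image under [X k] of the measure with density [W];
   integrating [F k] against it in both descriptions restores the [k]-th factor. *)
pose M := mscale (NngNum cn0) (distribution P Xk).
have key : (\int[M]_y (F k y)%:E = \int[P]_w ((F k (X k w))%:E * (W w)%:E))%E.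
  apply: ge0_integral_density_pushforward => //.
  - move=> A mA; transitivity ((fine c)%:E * P (X k @^-1` A))%E => //.
    by rewrite IHG// fineK.
  - exact/measurable_EFinP.
  - by move=> y; rewrite lee_fin.
rewrite (bigD1 (Ordinal kn))//= -/c.
under eq_integral do rewrite (bigD1 (Ordinal kn))//= EFinM.
rewrite -key ge0_integral_mscale//=; last 2 first.
- exact/measurable_EFinP.
- by move=> y _; rewrite lee_fin.
rewrite fineK// muleC; congr (_ * _)%E.
rewrite ge0_integral_distribution//.
- exact/measurable_EFinP.
- by move=> y; rewrite lee_fin.
Qed.

Lemma expectation_prod n (F : nat -> E -> R) :
  (forall i, measurable_fun [set: E] (F i)) ->
  (forall i x, 0 <= F i x) ->
  (forall i, (\int[P]_w (F i (X i w))%:E < +oo)%E) ->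
  (\int[P]_w (\prod_(i < n) F i (X i w))%:E =
   \prod_(i < n) \int[P]_w (F i (X i w))%:E)%E.
Proof.
move=> mF F0 Foo.
apply: (@expectation_prod_partial n n) => // i /andP[].
by rewrite leqNgt => /negbTE->.
Qed.

End independence.

(** * Gaussian exponential moments and the joint law of one observation *)

Lemma normal_mgf (R : realType) (mean sigma t : R) : sigma != 0 ->
  (\int[lebesgue_measure]_y
     (expR (t * (y - mean)) * normal_pdf mean sigma y)%:E =
   (expR (t ^+ 2 * sigma ^+ 2 / 2))%:E)%E.
Proof.
move=> sigma0.
(* Completing the square: the exponential tilt shifts the mean by [t * sigma ^+ 2] and leaves a
   constant factor. *)
under eq_integral => y _.
  rewrite (_ : _ * _ = expR (t ^+ 2 * sigma ^+ 2 / 2) *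
      normal_pdf (mean + t * sigma ^+ 2) sigma y); last first.
    rewrite !normal_pdfE// mulrCA [RHS]mulrCA; congr *%R.
    rewrite /normal_fun -!expRD; congr expR; field.
    exact: sigma0.
  rewrite EFinM; over.
rewrite ge0_integralZl//.
- by rewrite integral_normal_pdf// mule1.
- by apply/measurable_EFinP; exact: measurable_normal_pdf.
- by move=> y _; rewrite lee_fin normal_pdf_ge0.
Qed.

Section normal_regression.
Context d d' (T : measurableType d) (E : measurableType d') (R : realType).
Variables (P : probability T R) (nu : probability E R).
Variables (s : {RV P >-> E}) (Y : {RV P >-> R}) (u : E -> R) (sigma : R).
Hypotheses (mu : measurable_fun [set: E] u) (sigma_gt0 : 0 < sigma).
Hypothesis s_law : forall A, measurable A -> distribution P s A = nu A.
Hypothesis Y_law : forall (A : set E) (B : set R),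
  measurable A -> measurable B ->
  P (s @^-1` A `&` Y @^-1` B) =
  (\int[P]_(w in s @^-1` A) normal_prob (u (s w)) sigma B)%E.

Let q (z : E * R) := normal_pdf (u z.1) sigma z.2.

Let mq : measurable_fun [set: E * measurableTypeR R] q.
Proof.
have sigma0 : sigma != 0 by rewrite gt_eqF.
rewrite /q; under eq_fun do rewrite normal_pdfE//.
apply: measurable_funM => //; apply: measurableT_comp => //.
apply: measurable_funM => //; apply: measurableT_comp => //.
apply: measurable_funX => //; apply: measurable_funB => //.
exact: measurableT_comp.
Qed.

Let q0 z : 0 <= q z.
Proof. exact: normal_pdf_ge0. Qed.

Local Open Scope ereal_scope.

(* lebesgue_measure lives on measurableTypeR R: its measurable sets are those
   of R, but with another display, so that product spaces over the two types
   do not unify. *)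
Let leb : {sigma_finite_measure set (measurableTypeR R) -> \bar R} :=
  @lebesgue_measure R.

Let D := density (nu \x leb) mq q0.

(** By Tonelli, integrating the density over [y] in [B] gives [normal_prob (u x) sigma B];
    integrating that over [A] against [nu], the law of [s], gives the right-hand side of [Y_law]. *)
Lemma joint_law_rect A B : measurable A -> measurable B ->
  D (A `*` B) = P (s @^-1` A `&` Y @^-1` B).
Proof.
move=> mA mB; rewrite /D /density/= /density_measure integral_mkcond.
have mAB : measurable (A `*` B) by exact: measurableX.
set g := (_ \_ _).
have mg : measurable_fun [set: E * measurableTypeR R] g.
  apply/(measurable_restrictT _ _).1 => //.
  by apply: measurable_funTS; exact/measurable_EFinP.
have g0 z : 0 <= g z.
  by rewrite /g patchE; case: ifPn => // _; rewrite lee_fin.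
rewrite fubini_tonelli1//= Y_law//.
have FE x : fubini_F leb g x = ((fun x => normal_prob (u x) sigma B) \_ A) x.
  rewrite /fubini_F /g patchE.
  case: ifPn => [|]; rewrite ?(inE, notin_setE) => xA.
    rewrite /normal_prob [RHS]integral_mkcond; apply: eq_integral => y _.
    by rewrite !patchE in_setX mem_set.
  by apply: integral0_eq => y _; rewrite patchE in_setX memNset.
under eq_integral do rewrite FE.
have mF : measurable_fun [set: E] ((fun x => normal_prob (u x) sigma B) \_ A).
  have <- : fubini_F leb g = (fun x => normal_prob (u x) sigma B) \_ A.
    exact/funext.
  exact: measurable_fun_fubini_tonelli_F.
rewrite [RHS]integral_mkcond.
transitivity (\int[distribution P s]_x
    ((fun x => normal_prob (u x) sigma B) \_ A) x).
  by apply: eq_measure_integral => C mC _; exact/esym/s_law.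
rewrite ge0_integral_distribution// => x.
by apply: erestrict_ge0 => ? _; exact: measure_ge0.
Qed.

(** Rectangles are stable under intersection and generate the product sigma-algebra, so
    [joint_law_rect] identifies the law of [(s, Y)] with [D]; Tonelli then splits the integral. *)
Lemma joint_expectation (h : E * R -> \bar R) :
  measurable_fun [set: E * R] h -> (forall z, 0 <= h z) ->
  \int[P]_w h (s w, Y w) =
  \int[nu]_x \int[leb]_y (h (x, y) * (normal_pdf (u x) sigma y)%:E).
Proof.
move=> mh h0.
have mh' : measurable_fun [set: E * measurableTypeR R] h by exact: mh.
have mXY : measurable_fun [set: T]
    ((fun w => (s w, Y w)) : T -> E * measurableTypeR R).
  by apply: measurable_fun_pair => //; exact: (measurable_funP Y).
pose XY : {RV P >-> (E * measurableTypeR R)%type} :=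
  HB.pack (fun w => (s w, Y w)) (isMeasurableFun.Build _ _ _ _ _ mXY).
rewrite -[LHS](ge0_integral_distribution XY)//.
transitivity (\int[D]_z h z).
  apply: eq_measure_integral => C mC _.
  pose G : set (set (E * measurableTypeR R)) :=
    [set A `*` B | A in measurable & B in measurable].
  apply: (measure_unique G (fun=> setT)) => //.
  - exact: measurable_prod_measurableType.
  - move=> _ _ [A1 mA1 [B1 mB1 <-]] [A2 mA2 [B2 mB2 <-]].
    rewrite -setXI; exists (A1 `&` A2); first exact: measurableI.
    by exists (B1 `&` B2) => //; exact: measurableI.
  - by move=> _; exists setT => //; exists setT => //; rewrite setXTT.
  - by apply/seteqP; split => // x _; exists 0%N.
  - by move=> _ [A mA [B mB <-]]; rewrite /= joint_law_rect.
  - by move=> _; rewrite /= probability_setT ltry.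
rewrite ge0_integral_density// fubini_tonelli1//.
  by apply: emeasurable_funM => //; exact/measurable_EFinP.
by move=> z; rewrite mule_ge0// lee_fin.
Qed.

End normal_regression.

(** Markov's inequality at level 1: an exponential [g] gives Chernoff's bound, a rescaled sum the
    bound on the noise. *)
Lemma le_probability_expectation d (T : measurableType d) (R : realType)
    (P : probability T R) (A : set T) (g : T -> R) :
  measurable A -> measurable_fun [set: T] g -> (forall w, 0 <= g w) ->
  (forall w, A w -> 1 <= g w) -> (P A <= \int[P]_w (g w)%:E)%E.
Proof.
move=> mA mg g0 g1; rewrite -(setIT A) -integral_indic//.
apply: ge0_le_integral => //.
- by apply/measurable_EFinP.
- by apply/measurable_EFinP.
- move=> w _; rewrite lee_fin indicE.
  by case: (boolP (w \in A)) => // /set_mem /g1.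
Qed.

(** * Moment bounds for one observation *)

Section one_observation.
Context d d' (T : measurableType d) (E : measurableType d') (R : realType).
Variables (P : probability T R) (nu : probability E R).
Variables (s : {RV P >-> E}) (Y : {RV P >-> R}) (u : E -> R) (sigma : R).
Hypotheses (mu : measurable_fun [set: E] u) (sigma_gt0 : 0 < sigma).
Hypothesis s_law : forall A, measurable A -> distribution P s A = nu A.
Hypothesis Y_law : forall (A : set E) (B : set R),
  measurable A -> measurable B ->
  P (s @^-1` A `&` Y @^-1` B) =
  (\int[P]_(w in s @^-1` A) normal_prob (u (s w)) sigma B)%E.

(** Given [s], the exponent is affine in a Gaussian variable, so the inner integral is [normal_mgf].
    Slope and offset vary with the design point, as they do in a difference of squared losses. *)
Lemma expectation_expR_noise (t b : E -> R) :
  measurable_fun [set: E] t -> measurable_fun [set: E] b ->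
  (\int[P]_w (expR (t (s w) * (Y w - u (s w)) + b (s w)))%:E =
   \int[nu]_x (expR (t x ^+ 2 * sigma ^+ 2 / 2 + b x))%:E)%E.
Proof.
move=> mt mb.
pose h (z : E * R) := (expR (t z.1 * (z.2 - u z.1) + b z.1))%:E.
have sigma0 : sigma != 0 by rewrite gt_eqF.
rewrite -[LHS]/(\int[P]_w h (s w, Y w))%E.
rewrite (joint_expectation mu sigma_gt0 s_law Y_law); last 2 first.
- apply/measurable_EFinP; apply: measurableT_comp => //.
  apply: measurable_funD; last exact: measurableT_comp.
  apply: measurable_funM; first exact: measurableT_comp.
  by apply: measurable_funB => //; exact: measurableT_comp.
- by move=> z; rewrite lee_fin expR_ge0.
apply: eq_integral => x _; rewrite /h/=.
under eq_integral do rewrite -EFinM addrC expRD -mulrA EFinM.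
rewrite ge0_integralZl//.
- by rewrite normal_mgf// -EFinM -expRD addrC.
- apply/measurable_EFinP; apply: measurable_funM; last first.
    exact: measurable_normal_pdf.
  apply: measurableT_comp => //; apply: measurable_funM => //.
  exact: measurable_funB.
- by move=> y _; rewrite lee_fin mulr_ge0 ?expR_ge0 ?normal_pdf_ge0.
Qed.

(** From |e| <= exp(e) + exp(-e), a crude bound that reduces to the exponential moments at slopes 1
    and -1. *)
Lemma expectation_noise_le :
  (\int[P]_w (`|Y w - u (s w)|)%:E <= (2 * expR (sigma ^+ 2 / 2))%:E)%E.
Proof.
have mus : measurable_fun [set: T] (fun w => Y w - u (s w)).
  by apply: measurable_funB => //; exact: measurableT_comp.
have cst_exp r : r ^+ 2 = 1 ->
    (\int[P]_w (expR (r * (Y w - u (s w)) + 0))%:E =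
     (expR (sigma ^+ 2 / 2))%:E)%E.
  move=> r1; rewrite (expectation_expR_noise (t := cst r) (b := cst 0))//=.
  by rewrite r1 mul1r addr0 integral_cst//= probability_setT mule1.
have mexp r : measurable_fun [set: T]
    (fun w => (expR (r * (Y w - u (s w)) + 0))%:E).
  apply/measurable_EFinP; apply: measurableT_comp => //.
  by apply: measurable_funD => //; exact: measurable_funM.
apply: (@le_trans _ _ (\int[P]_w ((expR (1 * (Y w - u (s w)) + 0))%:E +
    (expR (-1 * (Y w - u (s w)) + 0))%:E))%E).
  apply: ge0_le_integral => //.
  - by apply/measurable_EFinP; exact: measurableT_comp.
  - exact: emeasurable_funD.
  - move=> w _; rewrite lee_fin mul1r mulN1r !addr0.
    set e := Y w - _; have := expR_ge1Dx e; have := expR_ge1Dx (- e).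
    have := expR_ge0 e; have := expR_ge0 (- e).
    by case: (lerP 0 e) => e0; [rewrite ger0_norm//|rewrite ltr0_norm//]; lra.
rewrite ge0_integralD//.
by rewrite !cst_exp ?sqrrN ?expr1n// -EFinD lee_fin mulr_natl mulr2n.
Qed.

(** With y = v(x) - u(x), the conditional moment at x is exp(-a) for a = y^2 / (8 sigma^2), and
    exp(-a) <= 1/(1 + a) = 1 - y^2 / (8 sigma^2 + y^2). Replacing y^2 by K^2 in the denominator
    alone leaves a bound affine in y^2, which integrates to 1 - c D <= exp(-c D). *)
Lemma expectation_expR_excess (v : E -> R) (K D : R) :
  measurable_fun [set: E] v -> (forall x, `|v x - u x| <= K) ->
  (\int[nu]_x ((v x - u x) ^+ 2)%:E = D%:E)%E ->
  (\int[P]_w (expR ((4 * sigma ^+ 2)^-1 *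
      ((Y w - u (s w)) ^+ 2 - (Y w - v (s w)) ^+ 2)))%:E <=
   (expR (- ((8 * sigma ^+ 2 + K ^+ 2)^-1 * D)))%:E)%E.
Proof.
move=> mv vK vD; set c := (_ + K ^+ 2)^-1.
have s2 : 0 < sigma ^+ 2 by rewrite exprn_gt0.
have mvu : measurable_fun [set: E] (fun x => v x - u x).
  exact: measurable_funB.
have mvu2 : measurable_fun [set: E] (fun x => (v x - u x) ^+ 2).
  exact: measurable_funX.
have vD0 : 0 <= D.
  rewrite -lee_fin -vD; apply: integral_ge0 => x _.
  by rewrite lee_fin sqr_ge0.
pose t x := (2 * sigma ^+ 2)^-1 * (v x - u x).
pose b x := - ((4 * sigma ^+ 2)^-1 * (v x - u x) ^+ 2).
have -> : (\int[P]_w (expR ((4 * sigma ^+ 2)^-1 *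
      ((Y w - u (s w)) ^+ 2 - (Y w - v (s w)) ^+ 2)))%:E =
    \int[P]_w (expR (t (s w) * (Y w - u (s w)) + b (s w)))%:E)%E.
  apply: eq_integral => w _; congr (expR _)%:E; rewrite /t /b; field.
  by rewrite gt_eqF.
rewrite expectation_expR_noise; last 2 first.
- exact: measurable_funM.
- by apply: measurableT_comp => //; exact: measurable_funM.
have c0 : 0 < c by rewrite invr_gt0 ltr_pwDl ?sqr_ge0 ?mulr_gt0.
have mexp : measurable_fun [set: E]
    (fun x => expR (t x ^+ 2 * sigma ^+ 2 / 2 + b x)).
  apply: measurableT_comp => //; apply: measurable_funD.
    apply: measurable_funM => //; apply: measurable_funM => //.
    by apply: measurable_funX; exact: measurable_funM.
  by apply: measurableT_comp => //; exact: measurable_funM.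
(* The bound 1 - c D is stated additively, so that only nonnegative functions are integrated. *)
have expDle1 : (\int[nu]_x (expR (t x ^+ 2 * sigma ^+ 2 / 2 + b x))%:E +
    (c * D)%:E <= 1)%E.
  rewrite EFinM -vD -ge0_integralZl_EFin//; last 3 first.
  - by move=> x _; rewrite lee_fin sqr_ge0.
  - exact/measurable_EFinP.
  - exact: ltW.
  rewrite -ge0_integralD//; last 3 first.
  - exact/measurable_EFinP.
  - by move=> x _; rewrite -EFinM lee_fin mulr_ge0 ?sqr_ge0 ?(ltW c0).
  - by apply/measurable_EFinP; exact: measurable_funM.
  rewrite -[leRHS](probability_setT nu) -[leRHS]mul1e -integral_cst//.
  apply: ge0_le_integral => //.
  - move=> x _; rewrite adde_ge0// -EFinM lee_fin.
    by rewrite mulr_ge0 ?sqr_ge0 ?(ltW c0).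
  - apply: emeasurable_funD; apply/measurable_EFinP => //.
    exact: measurable_funM.
  - move=> x _; rewrite /= -EFinM -EFinD lee_fin.
    set y := v x - u x.
    have y2K : y ^+ 2 <= K ^+ 2.
      rewrite -real_normK ?num_real// ler_sqr ?nnegrE ?normr_ge0//.
        exact: vK.
      exact: le_trans (normr_ge0 _) (vK x).
    pose a := y ^+ 2 / (8 * sigma ^+ 2).
    have -> : t x ^+ 2 * sigma ^+ 2 / 2 + b x = - a.
      by rewrite /t /b /a -/y; field; rewrite gt_eqF.
    have a0 : 0 <= a by rewrite divr_ge0 ?sqr_ge0// mulr_ge0// ltW.
    rewrite -lerBrDr expRN (le_trans (y := (1 + a)^-1))//.
      by rewrite lef_pV2 ?posrE ?expR_gt0 ?expR_ge1Dx// ltr_wpDr.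
    have -> : (1 + a)^-1 = 1 - (8 * sigma ^+ 2 + y ^+ 2)^-1 * y ^+ 2.
      rewrite /a; field.
      have := sqr_ge0 y.
      by rewrite !gt_eqF//=; nra.
    rewrite lerD2l lerN2 ler_wpM2r ?sqr_ge0// lef_pV2 ?posrE ?lerD2l//.
      by rewrite ltr_pwDl ?sqr_ge0 ?mulr_gt0.
    by rewrite ltr_pwDl ?sqr_ge0 ?mulr_gt0.
rewrite (le_trans (y := (1 - (c * D)%:E)%E))//; first by rewrite leeBrDr.
by rewrite -EFinB lee_fin expR_ge1Dx.
Qed.

End one_observation.

(** * Tail bounds for sums over the sample *)

Section sample.
Context d d' (T : measurableType d) (E : measurableType d') (R : realType).
Variables (P : probability T R) (nu : probability E R).
Variables (s : nat -> {RV P >-> E}) (Y : nat -> {RV P >-> R}).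
Variables (u : E -> R) (sigma : R).
Hypotheses (mu : measurable_fun [set: E] u) (sigma_gt0 : 0 < sigma).
Hypothesis sY_indep : mutually_independent P
  (fun i w => (s i w, Y i w) : (E * R)%type).
Hypothesis s_law : forall i A, measurable A -> distribution P (s i) A = nu A.
Hypothesis Y_law : forall i (A : set E) (B : set R),
  measurable A -> measurable B ->
  P (s i @^-1` A `&` Y i @^-1` B) =
  (\int[P]_(w in s i @^-1` A) normal_prob (u (s i w)) sigma B)%E.

Let measurable_excess i (v : E -> R) : measurable_fun [set: E] v ->
  measurable_fun [set: T]
    (fun w => (Y i w - u (s i w)) ^+ 2 - (Y i w - v (s i w)) ^+ 2).
Proof.
move=> mv; apply: measurable_funB; apply: measurable_funX;
  by apply: measurable_funB => //; exact: measurableT_comp.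
Qed.

Let measurable_event n (h : nat -> T -> R) (c : R) :
  (forall i, measurable_fun [set: T] (h i)) ->
  measurable_fun [set: T] (fun w => \sum_(i < n) h i w) /\
  measurable [set w | c <= \sum_(i < n) h i w].
Proof.
move=> mh.
have mS : measurable_fun [set: T] (fun w => \sum_(i < n) h i w).
  by apply: (@measurable_sum _ _ _ _ _ _ (fun i : 'I_n => h i)).
split=> //; rewrite (_ : mkset _ = (fun w => \sum_(i < n) h i w) @^-1`
    `[c, +oo[%classic); last first.
  by apply/seteqP; split => w /=; rewrite in_itv/= andbT.
by rewrite -[X in measurable X]setTI; exact: mS.
Qed.

Lemma measurable_excess_event n (v : E -> R) (c : R) :
  measurable_fun [set: E] v ->
  measurable [set w | c <= \sum_(i < n)
    ((Y i w - u (s i w)) ^+ 2 - (Y i w - v (s i w)) ^+ 2)].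
Proof.
move=> mv.
by have [] := @measurable_event n _ c (fun i => measurable_excess i mv).
Qed.

Let measurable_noise i :
  measurable_fun [set: T] (fun w => `|Y i w - u (s i w)|).
Proof.
apply: measurableT_comp => //; apply: measurable_funB => //.
exact: measurableT_comp.
Qed.

Lemma measurable_noise_event n (c : R) :
  measurable [set w | c <= \sum_(i < n) `|Y i w - u (s i w)|].
Proof. by have [] := @measurable_event n _ c measurable_noise. Qed.

(** Chernoff's bound at the fixed exponent 1/(4 sigma^2); independence turns the moment of the sum
    into a product of factors, each bounded by [expectation_expR_excess]. *)
Lemma excess_tail n (v : E -> R) (K D t : R) :
  measurable_fun [set: E] v -> (forall x, `|v x - u x| <= K) ->
  (\int[nu]_x ((v x - u x) ^+ 2)%:E = D%:E)%E ->
  (P [set w | (- t <= \sum_(i < n)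
      ((Y i w - u (s i w)) ^+ 2 - (Y i w - v (s i w)) ^+ 2))%R] <=
   (expR (t / (4 * sigma ^+ 2) -
      n%:R * ((8 * sigma ^+ 2 + K ^+ 2)^-1 * D)))%:E)%E.
Proof.
move=> mv vK vD; set A := [set w | _].
pose a := (4 * sigma ^+ 2)^-1.
have a_gt0 : 0 < a by rewrite invr_gt0 mulr_gt0// exprn_gt0.
pose F (z : E * R) := expR (a * ((z.2 - u z.1) ^+ 2 - (z.2 - v z.1) ^+ 2)).
pose S w := \sum_(i < n) ((Y i w - u (s i w)) ^+ 2 - (Y i w - v (s i w)) ^+ 2).
have mS : measurable_fun [set: T] S.
  by have [] := @measurable_event n _ 0 (fun i => measurable_excess i mv).
have mA : measurable A by exact: measurable_excess_event.
have mF : measurable_fun [set: E * R] F.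
  apply: measurableT_comp => //; apply: measurable_funM => //.
  apply: measurable_funB; apply: measurable_funX;
    by apply: measurable_funB => //; exact: measurableT_comp.
have SF w :
    expR (a * (t + S w)) = expR (a * t) * \prod_(i < n) F (s i w, Y i w).
  rewrite mulrDr expRD; congr *%R; rewrite mulr_sumr expR_sum.
  by apply: eq_bigr.
have F_le i : (\int[P]_w (F (s i w, Y i w))%:E <=
    (expR (- ((8 * sigma ^+ 2 + K ^+ 2)^-1 * D)))%:E)%E.
  exact: (expectation_expR_excess mu sigma_gt0 (s_law i) (Y_law i)).
apply: (@le_trans _ _ (\int[P]_w (expR (a * (t + S w)))%:E)%E).
  apply: le_probability_expectation => //.
  - apply: measurableT_comp => //; apply: measurable_funM => //.
    exact: measurable_funD.
  - move=> w /= Aw; rewrite -expR0 ler_expR mulr_ge0 ?(ltW a_gt0)//.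
    by rewrite -lerBlDl sub0r.
under eq_integral do rewrite SF EFinM.
rewrite ge0_integralZl_EFin ?expR_ge0//; last 2 first.
- by move=> w _; rewrite lee_fin; apply: prodr_ge0 => i _; exact: expR_ge0.
- apply/measurable_EFinP.
  apply: (@measurable_prod _ T R setT 'I_n (index_enum _)
    (fun i w => F (s i w, Y i w))) => i _.
  by apply: (measurableT_comp mF); exact: measurable_fun_pair.
have mX i : measurable_fun [set: T] (fun w => (s i w, Y i w)).
  exact: measurable_fun_pair.
rewrite (expectation_prod mX sY_indep n (F := fun=> F))//; last 2 first.
- by move=> _ z; exact: expR_ge0.
- by move=> i; rewrite (le_lt_trans (F_le i))// ltry.
set b := expR (- _) in F_le.
have prod_le k :
    (\prod_(i < k) \int[P]_w (F (s i w, Y i w))%:E <= (b ^+ k)%:E)%E.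
  have F0 i : (0 <= \int[P]_w (F (s i w, Y i w))%:E)%E.
    by apply: integral_ge0 => w _; rewrite lee_fin expR_ge0.
  elim: k => [|k IH]; first by rewrite big_ord0 expr0.
  by rewrite big_ord_recr/= exprSr EFinM lee_pmul// prode_ge0.
apply: le_trans (lee_wpmul2l _ (prod_le n)) _.
  by rewrite lee_fin expR_ge0.
by rewrite -EFinM lee_fin -expRM_natl -expRD mulrN /a [_ * t]mulrC.
Qed.

(** Markov's inequality with first moments bounded uniformly in [i]: the factor [n] cancels. *)
Lemma noise_tail n (M : R) : (0 < n)%N -> 0 < M ->
  (P [set w | (n%:R * M <= \sum_(i < n) `|Y i w - u (s i w)|)%R] <=
   (2 * expR (sigma ^+ 2 / 2) / M)%:E)%E.
Proof.
move=> n_gt0 M_gt0; set A := [set w | _].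
pose S w := \sum_(i < n) `|Y i w - u (s i w)|.
have nM_gt0 : 0 < n%:R * M by rewrite mulr_gt0// ltr0n.
have mS : measurable_fun [set: T] S.
  by have [] := @measurable_event n _ 0 measurable_noise.
have mA : measurable A by exact: measurable_noise_event.
apply: (@le_trans _ _ (\int[P]_w ((n%:R * M)^-1 * S w)%:E)%E).
  apply: le_probability_expectation => //.
  - exact: measurable_funM.
  - by move=> w; rewrite mulr_ge0 ?invr_ge0 ?(ltW nM_gt0)// sumr_ge0.
  - by move=> w Aw; rewrite mulrC ler_pdivlMr// mul1r.
under eq_integral do rewrite EFinM.
rewrite ge0_integralZl_EFin//; last 3 first.
- by move=> w _; rewrite lee_fin sumr_ge0.
- exact/measurable_EFinP.
- by rewrite invr_ge0 ltW.
under eq_integral do rewrite /S -sumEFin.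
rewrite ge0_integral_sum//; last first.
  by move=> i; exact/measurable_EFinP.
apply: (@le_trans _ _ (((n%:R * M)^-1)%:E *
    \sum_(i < n) (2 * expR (sigma ^+ 2 / 2))%:E)%E).
  apply: lee_wpmul2l; first by rewrite lee_fin invr_ge0 ltW.
  apply: lee_sum => i _.
  exact: (expectation_noise_le mu sigma_gt0 (s_law i) (Y_law i)).
rewrite sumEFin -EFinM lee_fin sumr_const card_ord -mulr_natl.
rewrite le_eqVlt; apply/orP; left; apply/eqP; field.
by rewrite gt_eqF//= pnatr_eq0 -lt0n.
Qed.

End sample.

(** * Borel measurability on R^m and the squared L^2 norm *)

Lemma open_continuous_borelRV_measurable (R : realType) m
    (Om : set 'rV[R]_m) (f : 'rV[R]_m -> R) :
  open Om -> (forall x, Om x -> {for x, continuous f}) ->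
  @measurable_fun _ _ (borelRV R m) R Om f.
Proof.
move=> oOm cf; apply: (measurability _ (RGenOpens.measurableE R)).
move=> _ [_ [a [b ->] <-]]; apply: sub_sigma_algebra.
rewrite openE => x [Ox fx].
have Vab : nbhs (f x) `]a, b[%classic by apply: open_nbhs_nbhs; split => //.
by apply: filterI; [exact: open_nbhs_nbhs|exact: cf].
Qed.

Lemma sqr_poweR_inv2 (R : realType) (x : \bar R) :
  (0 <= x -> (x `^ 2^-1) ^+ 2 = x)%E.
Proof.
case: x => [r|_|//]; last by rewrite poweRyr ?invr_neq0// expe2 mulyy.
by rewrite lee_fin => r0; rewrite poweR_EFin powR12_sqrt// -EFin_expe sqr_sqrtr.
Qed.

Lemma sqr_L2norm_scal (R : realType) m (Om : set 'rV[R]_m)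
    (nu : probability (borelRV R m) R) (g : 'rV[R]_m -> R) :
  (L2norm Om nu (scal g) ^+ 2 = \int[nu]_(x in Om) (g x ^+ 2)%:E)%E.
Proof.
rewrite sqr_poweR_inv2; last first.
  by apply: integral_ge0 => x _; rewrite lee_fin sqr_ge0.
apply: eq_integral => x _; congr EFin.
rewrite /enorm sqr_sqrtr ?sumr_ge0// => [|i _]; last exact: sqr_ge0.
by rewrite big_ord1 /scal mxE eqxx mulr1n.
Qed.

(** * Norms and nets in R^d, the union bound, perturbation of the squared loss *)

Lemma enorm_le (R : realType) d (v : 'rV[R]_d) (b : R) :
  0 <= b -> (forall i, `|v 0 i| <= b) -> enorm v <= d%:R * b.
Proof.
move=> b0 vb.
rewrite -[leRHS]ger0_norm ?mulr_ge0// -sqrtr_sqr ler_wsqrtr//.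
apply: (@le_trans _ _ (\sum_(i < d) b ^+ 2)).
  apply: ler_sum => i _.
  by rewrite -real_normK ?num_real// ler_sqr ?nnegrE ?vb.
rewrite sumr_const card_ord -[leLHS]mulr_natl exprMn ler_wpM2r ?sqr_ge0//.
(* Using d <= d^2 loses a factor sqrt(d) against the sharp bound; as [d] is fixed, this affects
   constants only. *)
rewrite -natrX ler_nat -mulnn.
by case: (d) => // k; rewrite leq_pmulr.
Qed.

Lemma row_entry_le_norm (R : realType) d (v : 'rV[R]_d) i : `|v 0 i| <= `|v|.
Proof.
rewrite [leRHS]/Num.Def.normr/= mx_normrE.
exact: (le_bigmax _ (fun ij => `|v ij.1 ij.2|) (0, i)).
Qed.

(** The box [-b, b]^d is cut into cubes of side 1/q, at most 2 b q + 1 <= (2 b + 1) q per axis as q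
    >= 1, and a point of [Theta] is chosen in each cube that meets [Theta]. Net points in [Theta]
    keep the Lipschitz bound available. *)
Lemma finite_net (R : realType) d (Theta : set 'rV[R]_d) (b q : R) theta0 :
  0 <= b -> 1 <= q -> Theta theta0 ->
  (forall theta, Theta theta -> forall i, `|theta 0 i| <= b) ->
  exists (J : finType) (net : J -> 'rV[R]_d),
    [/\ #|J|%:R <= ((2 * b + 1) * q) ^+ d, forall j, Theta (net j) &
      forall theta, Theta theta ->
        exists j, forall i, `|theta 0 i - net j 0 i| <= q^-1].
Proof.
move=> b0 q1 Theta0 Theta_b.
have q0 : 0 < q by exact: lt_le_trans q1.
pose N := Num.truncn (2 * b * q).
pose J : finType := {ffun 'I_d -> 'I_N.+1}.
pose cell (theta : 'rV[R]_d) : J :=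
  [ffun i => inord (Num.truncn ((theta 0 i + b) * q))].
have cellE theta i : Theta theta ->
    (cell theta i)%:R <= (theta 0 i + b) * q < (cell theta i).+1%:R.
  move=> /Theta_b/(_ i); rewrite ler_norml => /andP[bl bu].
  have x0 : 0 <= (theta 0 i + b) * q.
    by apply: mulr_ge0; [rewrite -lerBlDr sub0r|exact: ltW].
  rewrite ffunE inordK; first exact: truncn_itv.
  rewrite ltnS; apply: le_truncn.
  by rewrite ler_pM2r// mulr_natl mulr2n lerD2r.
(* A cube that misses [Theta] receives the default [theta0], so every net point is in [Theta]. *)
exists J, (fun j => xget theta0 [set theta | Theta theta /\ cell theta = j]).
split.
- rewrite card_ffun !card_ord natrX; apply: lerXn2r; rewrite ?nnegrE//.
    by rewrite mulr_ge0 ?(ltW q0)// addr_ge0 ?mulr_ge0.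
  have bq0 : 0 <= 2 * b * q by rewrite !mulr_ge0// ltW.
  by have /andP[Nle _] := truncn_itv bq0; rewrite -natr1 mulrDl mul1r lerD.
- by move=> j; case: xgetP => // theta _ [].
- move=> theta Th; exists (cell theta) => i.
  case: xgetP => [theta' _ [Th' cellEE]|/(_ theta)]; last by case.
  have := cellE _ i Th; have := cellE _ i Th'; rewrite cellEE -natr1.
  rewrite -[q^-1]mul1r ler_pdivlMr//.
  rewrite -[in X in _ -> _ -> _ * X <= _](gtr0_norm q0).
  rewrite -normrM ler_norml.
  by move=> /andP[h1 h2] /andP[h3 h4]; apply/andP; split; lra.
Qed.

Lemma measure_bigsetU_le d (T : measurableType d) (R : realType)
    (mu : {measure set T -> \bar R}) (I : finType) (Q : pred I)
    (A : I -> set T) :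
  (forall i, measurable (A i)) ->
  measurable (\big[setU/set0]_(i | Q i) A i) /\
  (mu (\big[setU/set0]_(i | Q i) A i) <= \sum_(i | Q i) mu (A i))%E.
Proof.
move=> mA; apply: (big_rec2 (fun X y => measurable X /\ (mu X <= y)%E)).
  by rewrite measure0.
move=> i y X _ [mX Xy]; split; first exact: measurableU.
apply: (le_trans (measureU2 _ _ _)) => //; exact: leeD2l.
Qed.

(** Here [a] is the truth, [p] a competitor at least as good on the sample and [q] its neighbour in
    the net. Factoring (y - p)^2 - (y - q)^2 by p - q shows that passing from [p] to [q] costs at
    most eps (2 |y - a| + 2 K) per observation. *)
Lemma least_squares_excess (R : realType) n (y a p q : 'I_n -> R)
    (K eps M : R) :
  (forall i, `|p i - a i| <= K) -> (forall i, `|q i - a i| <= K) ->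
  (forall i, `|p i - q i| <= eps) ->
  \sum_i (y i - p i) ^+ 2 <= \sum_i (y i - a i) ^+ 2 ->
  \sum_i `|y i - a i| <= n%:R * M ->
  - (n%:R * eps * (2 * M + 2 * K)) <=
  \sum_i ((y i - a i) ^+ 2 - (y i - q i) ^+ 2).
Proof.
(* An observation is what forces [eps] to be nonnegative; without any, both sides are 0. *)
case: n y a p q => [|n] y a p q pa qa pq pmin noise.
  by rewrite !mul0r oppr0 big_ord0.
have eps0 : 0 <= eps by exact: le_trans (normr_ge0 _) (pq ord0).
apply: (@le_trans _ _ (\sum_i ((y i - p i) ^+ 2 - (y i - q i) ^+ 2)));
    last first.
  by rewrite !sumrB lerD2r.
apply: (@le_trans _ _ (\sum_i - (eps * (2 * `|y i - a i| + 2 * K)))).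
  rewrite sumrN lerN2 -mulr_sumr big_split/= -mulr_sumr sumr_const card_ord.
  rewrite [n.+1%:R * _]mulrC -mulrA ler_wpM2l// -[_ *+ n.+1]mulr_natl.
  by rewrite mulrDr lerD// mulrCA ler_pM2l.
apply: ler_sum => i _.
have -> : (y i - p i) ^+ 2 - (y i - q i) ^+ 2 =
   - ((p i - q i) * (2 * (y i - a i) - (p i - a i) - (q i - a i))) by ring.
rewrite lerN2 (le_trans (ler_norm _))// normrM ler_pM//.
rewrite (le_trans (ler_normB _ _))// (_ : 2 * K = K + K); last first.
  by rewrite mulr_natl.
rewrite addrA lerD// (le_trans (ler_normB _ _))// lerD//.
by rewrite normrM ger0_norm.
Qed.

(** * Least squares over a Lipschitz parametric class *)

Section lipschitz_class.
Context d' (E : measurableType d') (R : realType) (d : nat).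
Variables (nu : probability E R) (Theta : set 'rV[R]_d).
Variables (g : 'rV[R]_d -> E -> R).
Variables (b L : R) (theta0 : 'rV[R]_d).
Hypotheses (L_ge0 : 0 <= L) (b_ge0 : 0 <= b) (Theta0 : Theta theta0).
Hypothesis Theta_b : forall theta, Theta theta -> forall i, `|theta 0 i| <= b.
Hypothesis mg : forall theta, Theta theta -> measurable_fun [set: E] (g theta).
Hypothesis g_lip : forall theta1 theta2, Theta theta1 -> Theta theta2 ->
  forall x, `|g theta1 x - g theta2 x| <= L * enorm (theta1 - theta2).

(** [L] times a bound on the Euclidean diameter of the box [-b, b]^d; it serves as the K of the
    moment bound. *)
Definition class_diam := L * (d%:R * (2 * b)).

(** For [theta] in [Theta] the integral is finite, the class being uniformly bounded, so [fine]
    loses nothing there. *)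
Definition sqdist theta :=
  fine (\int[nu]_x ((g theta x - g theta0 x) ^+ 2)%:E)%E.

Lemma class_diam_ge0 : 0 <= class_diam.
Proof. by rewrite !mulr_ge0. Qed.

Lemma class_diamP theta : Theta theta ->
  forall x, `|g theta x - g theta0 x| <= class_diam.
Proof.
move=> Th x; apply: (le_trans (g_lip Th Theta0 x)); rewrite ler_wpM2l//.
apply: enorm_le => [|i]; first by rewrite mulr_ge0.
rewrite !mxE (le_trans (ler_normB _ _))// mulr_natl mulr2n.
by rewrite lerD// Theta_b.
Qed.

Let m_sq theta : Theta theta ->
  measurable_fun [set: E] (fun x => (g theta x - g theta0 x) ^+ 2).
Proof.
by move=> Th; apply: measurable_funX; apply: measurable_funB; exact: mg.
Qed.

Lemma sqdistE theta : Theta theta ->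
  (\int[nu]_x ((g theta x - g theta0 x) ^+ 2)%:E = (sqdist theta)%:E)%E.
Proof.
move=> Th; rewrite fineK// ge0_fin_numE; last first.
  by apply: integral_ge0 => x _; rewrite lee_fin sqr_ge0.
apply: (@le_lt_trans _ _ (\int[nu]_x (cst (class_diam ^+ 2)%:E x))%E).
  apply: ge0_le_integral => //.
  - by move=> x _; rewrite lee_fin sqr_ge0.
  - by apply/measurable_EFinP; exact: m_sq.
  - move=> x _; rewrite lee_fin -real_normK ?num_real//.
    by rewrite ler_sqr ?nnegrE ?class_diam_ge0// class_diamP.
by rewrite integral_cst//= probability_setT mule1 ltry.
Qed.

Lemma sqdist_le theta1 theta2 (eps : R) : Theta theta1 -> Theta theta2 ->
  (forall x, `|g theta1 x - g theta2 x| <= eps) ->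
  sqdist theta1 <= sqdist theta2 + eps * (2 * class_diam).
Proof.
move=> Th1 Th2 g12.
have eps0 (x : E) : 0 <= eps by exact: le_trans (normr_ge0 _) (g12 x).
rewrite -lee_fin EFinD -!sqdistE//.
rewrite -[X in (_ + X)%E]mule1 -[X in (_ + _ * X)%E](probability_setT nu).
rewrite -integral_cst// -ge0_integralD//; last 3 first.
- by move=> x _; rewrite lee_fin sqr_ge0.
- by apply/measurable_EFinP; exact: m_sq.
- by move=> x _; rewrite lee_fin !mulr_ge0 ?class_diam_ge0 ?(eps0 x).
apply: ge0_le_integral => //.
- by move=> x _; rewrite lee_fin sqr_ge0.
- by apply/measurable_EFinP; exact: m_sq.
- apply: emeasurable_funD => //; apply/measurable_EFinP; exact: m_sq.
- move=> x _; rewrite -EFinD lee_fin -lerBlDl.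
  set a1 := g theta1 x - _; set a2 := g theta2 x - _.
  have -> : a1 ^+ 2 - a2 ^+ 2 = (g theta1 x - g theta2 x) * (a1 + a2).
    by rewrite /a1 /a2; ring.
  rewrite (le_trans (ler_norm _))// normrM ler_pM//.
  rewrite (le_trans (ler_normD _ _))// mulr_natl mulr2n.
  by rewrite lerD ?class_diamP.
Qed.

Variables (sigma : R) (disp : measure_display) (T : measurableType disp).
Variables (P : probability T R).
Variables (s : nat -> {RV P >-> E}) (Y : nat -> {RV P >-> R}).
Hypothesis sigma_gt0 : 0 < sigma.
Hypothesis sY_indep : mutually_independent P
  (fun i w => (s i w, Y i w) : (E * R)%type).
Hypothesis s_law : forall i A, measurable A -> distribution P (s i) A = nu A.
Hypothesis Y_law : forall i (A : set E) (B : set R),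
  measurable A -> measurable B ->
  P (s i @^-1` A `&` Y i @^-1` B) =
  (\int[P]_(w in s i @^-1` A) normal_prob (g theta0 (s i w)) sigma B)%E.

(** The inverse of the rate c in the exponential moment bound. *)
Definition tail_scale : R := 8 * sigma ^+ 2 + class_diam ^+ 2.

Lemma tail_scale_gt0 : 0 < tail_scale.
Proof. by rewrite ltr_pwDl ?sqr_ge0 ?mulr_gt0 ?exprn_gt0. Qed.

(** The two terms bound a large total noise and the union over the net. In the threshold, the
    summand with [class_diam] pays for moving to the net and the one with [tail_scale] makes the
    deviation bounds beat the cardinality of the net. *)
Lemma least_squares_tail n (q M : R) : (0 < n)%N -> (0 < d)%N ->
  q = n%:R / d%:R -> 1 <= ln q -> 1 <= q -> 0 < M ->
  (mu_ext P [set w | exists theta, [/\ Theta theta,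
      (\sum_(i < n) (Y i w - g theta (s i w)) ^+ 2 <=
      \sum_(i < n) (Y i w - g theta0 (s i w)) ^+ 2)%R &
      ((2 * L * d%:R * class_diam + 2 * tail_scale) * (q^-1 * ln q) <
        sqdist theta)%R]] <=
   (2 * expR (sigma ^+ 2 / 2) / M +
    (2 * b + 1) ^+ d *
    expR (L * d%:R ^+ 2 * (2 * M + 2 * class_diam) / (4 * sigma ^+ 2)) /
    q)%:E)%E.
Proof.
move=> n_gt0 d_gt0 qE lnq q1 M_gt0.
have q_gt0 : 0 < q by exact: lt_le_trans q1.
have [J [net [Jcard netT netP]]] := finite_net b_ge0 q1 Theta0 Theta_b.
(* The uniform distance from a member of the class to its neighbour in the net. With mesh d/n, n h =
   L d^2 is free of [n], and so is the slack [t]. *)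
pose h := L * (d%:R * q^-1).
have nh : n%:R * h = L * d%:R ^+ 2.
  rewrite /h qE; field.
  by rewrite !pnatr_eq0 -!lt0n n_gt0 d_gt0.
pose t := n%:R * h * (2 * M + 2 * class_diam).
pose r := q^-1 * ln q.
pose A := [set w | n%:R * M <= \sum_(i < n) `|Y i w - g theta0 (s i w)|].
pose B j := [set w | - t <= \sum_(i < n)
  ((Y i w - g theta0 (s i w)) ^+ 2 - (Y i w - g (net j) (s i w)) ^+ 2)].
pose Q j := 2 * tail_scale * r < sqdist (net j).
have mA : measurable A by exact: measurable_noise_event (mg Theta0) _ _.
have mB j : measurable (B j).
  exact: measurable_excess_event (mg Theta0) _ _ _ (mg (netT j)).
have [mBQ BQ_le] := measure_bigsetU_le P Q mB.
have h_net theta j : Theta theta ->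
    (forall i, `|theta 0 i - net j 0 i| <= q^-1) ->
    forall x, `|g theta x - g (net j) x| <= h.
  move=> Th thj x; apply: (le_trans (g_lip Th (netT j) x)); rewrite ler_wpM2l//.
  apply: enorm_le => [|i]; first by rewrite invr_ge0 ltW.
  by rewrite !mxE.
set S := [set w | _].
have SAB : S `<=` A `|` \big[setU/set0]_(j | Q j) B j.
  move=> w [theta [Th argmin far]].
  have [Aw|nAw] := pselect (A w); first by left.
  have [j thj] := netP _ Th; have thj_h := h_net _ _ Th thj.
  have Qj : Q j.
    (* As ln q >= 1, the net error 2 L d K / q is within the first summand of the threshold, so the
       neighbour is still far. *)
    have rq : q^-1 <= r by rewrite /r ler_peMr// invr_ge0 ltW.
    have := ler_wpM2l (_ : 0 <= 2 * L * d%:R * class_diam) rq.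
    rewrite !mulr_ge0 ?class_diam_ge0// => /(_ isT) net_err.
    have := sqdist_le Th (netT j) thj_h.
    have -> : h * (2 * class_diam) = 2 * L * d%:R * class_diam * q^-1.
      by rewrite /h; ring.
    move: far; rewrite -/r mulrDl /Q; lra.
  right; rewrite (bigD1 j)//=; left.
  apply: (least_squares_excess (p := fun i => g theta (s i w))) => //.
  - by move=> i; exact: class_diamP.
  - by move=> i; exact: class_diamP.
  - by rewrite ltW// ltNge; apply/negP.
apply: (le_trans (le_mu_ext _ SAB)).
rewrite measurable_mu_extE; last exact: measurableU.
apply: (le_trans (measureU2 _ mA mBQ)); rewrite EFinD leeD//.
  exact: (noise_tail (mg Theta0) sigma_gt0 s_law Y_law).
apply: (le_trans BQ_le).
set tau := expR _.
(* Beyond 2 r times [tail_scale], the exponent is at most -2 n r = -2 d ln q up to the constant in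
   [tau]. Of the resulting q^(-2d), one half cancels the q^d of the net and the other is at most
   1/q. *)
have Bj_le j : Q j -> (P (B j) <= (tau / (q ^+ d) ^+ 2)%:E)%E.
  move=> Qj.
  have := excess_tail (mg Theta0) sigma_gt0 sY_indep s_law Y_law n t
    (mg (netT j)) (class_diamP (netT j)) (sqdistE (netT j)).
  move=> /le_trans; apply; rewrite lee_fin.
  have qd : q ^+ d = expR (d%:R * ln q) by rewrite expRM_natl lnK.
  rewrite qd -expRM_natl -expRN -expRD ler_expR /t nh lerD2l lerN2.
  have nr : d%:R * ln q = n%:R * r.
    rewrite /r mulrA; congr *%R; rewrite qE; field.
    by rewrite !pnatr_eq0 -!lt0n n_gt0 d_gt0.
  rewrite nr mulrCA ler_wpM2l// -/tail_scale ler_pdivlMl; last first.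
    exact: tail_scale_gt0.
  by rewrite mulrCA mulrA ltW.
apply: (@le_trans _ _ (\sum_(j | Q j) (tau / (q ^+ d) ^+ 2)%:E)%E).
  exact: lee_sum.
rewrite sumEFin lee_fin.
have qd_gt0 : 0 < q ^+ d by rewrite exprn_gt0.
have X_ge0 : 0 <= tau / (q ^+ d) ^+ 2 by rewrite divr_ge0 ?expR_ge0 ?sqr_ge0.
apply: (@le_trans _ _ (\sum_(j : J) tau / (q ^+ d) ^+ 2)).
  by rewrite big_mkcond/= ler_sum// => j _; case: ifP.
rewrite sumr_const -[leLHS]mulr_natl (le_trans (ler_wpM2r X_ge0 Jcard))//.
have -> : ((2 * b + 1) * q) ^+ d * (tau / (q ^+ d) ^+ 2) =
    (2 * b + 1) ^+ d * tau / q ^+ d.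
  rewrite exprMn -[in LHS]mulrA; set c := _ ^+ d; rewrite -mulrA; congr *%R.
  by move: qd_gt0; set p := q ^+ d => p_gt0; field; rewrite gt_eqF.
rewrite ler_wpM2l ?lef_pV2 ?posrE//.
  by rewrite mulr_ge0 ?expR_ge0// exprn_ge0// addr_ge0// mulr_ge0.
by rewrite -[leLHS]expr1 ler_weXn2l.
Qed.

End lipschitz_class.

(** * The least squares estimator over the class of PDE solutions *)

Theorem theorem2p7 (R : realType) (m d d1 : nat)
  (m_gt0 : (0 < m)%N) (d_gt0 : (0 < d)%N)
  (Om : set 'rV[R]_m)
  (Om_open : open Om) (Om_connected : connected Om)
  (Om_bounded : bounded_set Om) (Om_smooth : smooth_boundary Om)
  (nu : probability (borelRV R m) R) (nu_Om : nu Om = 1%E)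
  (f : 'rV[R]_m -> R) (f_L2 : in_L2 Om nu (scal f))
  (H0 : ('rV[R]_m -> R) -> 'rV[R]_m -> R)
  (H1 : ('rV[R]_m -> R) -> 'rV[R]_m -> 'rV[R]_d)
  (B : ('rV[R]_m -> R) -> 'rV[R]_m -> 'rV[R]_d1)
  (H0_L2 : L2_operator Om nu (fun u => scal (H0 u)))
  (H1_L2 : L2_operator Om nu H1)
  (B_L2 : L2_operator Om nu B)
  (tau : R) (tau_gt0 : 0 < tau)
  (H0_diff : differential_operator Om nu tau (fun u => scal (H0 u)))
  (H1_diff : differential_operator Om nu tau H1)
  (H_order : operator_of_order Om nu tau (joint_operator H0 H1))
  (Theta : set 'rV[R]_d) (Theta_compact : compact Theta)
  (beta : R) (beta_gt0 : 0 < beta)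
  (Gamma : 'rV[R]_d -> 'rV[R]_m -> R)
  (Gamma_holder : forall theta, Theta theta ->
     holder_space Om beta (Gamma theta))
  (Gamma_solves : forall theta, Theta theta ->
     solves_pde Om nu H0 H1 B f theta (Gamma theta))
  (Gamma_unique : forall theta v, Theta theta -> holder_space Om beta v ->
     solves_pde Om nu H0 H1 B f theta v ->
     forall x, Om x -> v x = Gamma theta x)
  (L : R) (L_gt0 : 0 < L)
  (Gamma_lipschitz : forall theta1 theta2, Theta theta1 -> Theta theta2 ->
     (supnorm Om (fun x => Gamma theta1 x - Gamma theta2 x)%R
      <= (L * enorm (theta1 - theta2))%:E)%E)
  (theta_star : 'rV[R]_d) (theta_star_in : Theta theta_star)
  (sigma : R) (sigma_gt0 : 0 < sigma)
  (disp : measure_display) (T : measurableType disp) (P : probability T R)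
  (s : nat -> {RV P >-> borelRV R m}) (Y : nat -> {RV P >-> R})
  (s_Om : forall i w, Om (s i w))
  (sY_indep : mutually_independent P
     (fun i w => (s i w, Y i w) : (borelRV R m * R)%type))
  (s_law : forall i (A : set (borelRV R m)), measurable A ->
     distribution P (s i) A = nu A)
  (Y_law : forall i, conditionally_normal (s i) (Y i) (Gamma theta_star) sigma)
  (uhat : nat -> T -> 'rV[R]_m -> R)
  (uhat_argmin : forall n w, (0 < n)%N ->
     is_argmin (Gamma @` Theta)
       (fun u => n%:R^-1 * \sum_(i < n) (Y i w - u (s i w)) ^+ 2)
       (uhat n w)) :
  Op P
    (fun n w => L2norm Om nu
       (scal (fun x => uhat n w x - Gamma theta_star x)%R) ^+ 2)%E
    (fun n => d%:R / n%:R * ln (n%:R / d%:R)).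
Proof.
move=> eps eps_gt0.
have [b b_gt0 Theta_b] : exists2 b : R, 0 < b &
    forall theta, Theta theta -> forall i, `|theta 0 i| <= b.
  have /ex_strict_bound_gt0[b b_gt0 Tb] := compact_bounded Theta_compact.
  exists b => // theta /Tb/ltW th i; exact: le_trans (row_entry_le_norm _ _) th.
have mOm : @measurable _ (borelRV R m) Om by exact: sub_sigma_algebra.
(* Only the values on Om are known to be measurable. *)
pose g theta : borelRV R m -> R := Gamma theta \_ Om.
have g_Om theta x : Om x -> g theta x = Gamma theta x.
  by move=> Ox; rewrite /g patchE mem_set.
have mg theta : Theta theta -> measurable_fun [set: borelRV R m] (g theta).
  move=> Th; apply/(measurable_restrictT _ mOm).
  apply: open_continuous_borelRV_measurable => // x Ox.
  have [cont_diff _] := Gamma_holder _ Th.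
  by have [] := cont_diff [::] beta_gt0 x Ox.
have g_lip theta1 theta2 : Theta theta1 -> Theta theta2 ->
    forall x, `|g theta1 x - g theta2 x| <= L * enorm (theta1 - theta2).
  move=> Th1 Th2 x; rewrite /g !patchE; case: ifPn => [/set_mem Ox|_].
    rewrite -lee_fin; apply: le_trans (Gamma_lipschitz _ _ Th1 Th2).
    by apply: ereal_sup_ubound; exists x.
  by rewrite subrr normr0 mulr_ge0 ?(ltW L_gt0)// sqrtr_ge0.
have Y_law' i (A : set (borelRV R m)) (C : set R) :
    measurable A -> measurable C -> P (s i @^-1` A `&` Y i @^-1` C) =
    (\int[P]_(w in s i @^-1` A) normal_prob (g theta_star (s i w)) sigma C)%E.
  move=> mA mC; apply: (eq_trans (Y_law i A C mA mC)).
  apply: eq_integral => w _.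
  by rewrite g_Om.
have L_ge0 := ltW L_gt0; have b_ge0 := ltW b_gt0.
have sqdist_L2norm theta : Theta theta ->
    (L2norm Om nu (scal (fun x => Gamma theta x - Gamma theta_star x)%R) ^+ 2 =
     (sqdist nu g theta_star theta)%:E)%E.
  move=> Th; rewrite sqr_L2norm_scal.
  rewrite -(sqdistE nu L_ge0 b_ge0 theta_star_in Theta_b mg g_lip Th).
  rewrite integral_mkcond; apply: eq_integral => x _; rewrite /g !patchE.
  by case: ifPn => // _; rewrite subrr expr0n.
(* [Me] makes the noise term equal to eps/2; [C], the coefficient of 1/q in the other term, is free
   of [n]. *)
pose K := class_diam d b L; pose Me := 4 * expR (sigma ^+ 2 / 2) / eps.
pose C := (2 * b + 1) ^+ d *
  expR (L * d%:R ^+ 2 * (2 * Me + 2 * K) / (4 * sigma ^+ 2)).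
have Me_gt0 : 0 < Me by rewrite divr_gt0// mulr_gt0 ?expR_gt0.
have C_gt0 : 0 < C.
  by rewrite mulr_gt0 ?expR_gt0// exprn_gt0// addr_gt0// mulr_gt0.
exists (2 * L * d%:R * K + 2 * tail_scale d b L sigma).
(* For large [n], q >= e gives ln q >= 1, and q >= 2 C / eps gives C / q <= eps/2. *)
near=> n.
pose q : R := n%:R / d%:R.
have d0 : 0 < d%:R :> R by rewrite ltr0n.
have q_e : expR 1 <= q.
  rewrite ler_pdivlMr//; near: n; exact: nbhs_infty_ger.
have q_C : 2 * C / eps <= q.
  rewrite /q ler_pdivlMr//; near: n; exact: nbhs_infty_ger.
have q1 : 1 <= q by apply: le_trans q_e; rewrite -[leLHS]expR0 ler_expR.
have q0 : 0 < q by exact: lt_le_trans q1.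
have lnq : 1 <= ln q by rewrite -[leLHS]expRK ler_ln ?posrE ?expR_gt0.
have n_gt0 : (0 < n)%N.
  rewrite lt0n -(pnatr_eq0 R); apply: contraTneq q0 => n0.
  by rewrite /q n0 mul0r ltxx.
have r_gt0 : 0 < q^-1 * ln q.
  by rewrite mulr_gt0 ?invr_gt0// (lt_le_trans _ lnq).
apply: (@le_trans _ _ (2 * expR (sigma ^+ 2 / 2) / Me + C / q)%:E); last first.
  rewrite lee_fin (splitr eps) lerD//.
    rewrite /Me le_eqVlt; apply/orP; left; apply/eqP; field.
    by rewrite !gt_eqF ?expR_gt0.
  by move: q_C; rewrite !ler_pdivrMr//; lra.
have := least_squares_tail L_ge0 b_ge0 theta_star_in Theta_b mg g_lip sigma_gt0
  sY_indep s_law Y_law' n_gt0 d_gt0 erefl lnq q1 Me_gt0.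
(* By monotonicity of the outer probability, it suffices that each bad outcome provides a parameter
   for the event of [least_squares_tail]; a parameter of [uhat n w] does. *)
apply: le_trans; apply: le_mu_ext => w; rewrite /mkset.
have [[theta Th <-] argmin] := uhat_argmin n w n_gt0.
rewrite (sqdist_L2norm _ Th) -EFinM lte_fin => far; exists theta; split => //.
  have := argmin (Gamma theta_star); rewrite ler_pM2l ?invr_gt0 ?ltr0n//.
  move=> /(_ (ex_intro2 _ _ _ theta_star_in erefl)).
  by under eq_bigr do rewrite -g_Om//;
    under [X in _ <= X -> _]eq_bigr do rewrite -g_Om//.
have sq0 : 0 <= sqdist nu g theta_star theta.
  by rewrite -lee_fin -sqdist_L2norm//; exact: sqre_ge0.
move: far; rewrite -/q (_ : d%:R / n%:R = q^-1); last by rewrite /q invf_div.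
by rewrite ger0_norm ?ltr_pdivlMr// divr_ge0// ltW.
Unshelve. all: by end_near.
Qed.
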